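(* Let $N\ge1$ be an integer and $\chi$ a Dirichlet character of conductor $f$. For $n\ge 1$, \[ B_{N,n,\chi}=\sum_{k=0}^n\frac{k!}{f^{N-k}}\binom{n}{k}\sum_{r=0}^k T_r(k)\, S_{n-k}, \qquad B_{N,n,\chi}(x)=\sum_{k=0}^n\frac{k!}{f^{N-k}}\binom{n}{k}\sum_{r=0}^k T_r(k)\, S_{n-k}(x), \] where \[ T_r(k):=(-N!)^r\sum_{\substack{i_1+\cdots+i_r=k\\ i_1,\dots,i_r\ge 1}}\frac{1}{(N+i_1)!\cdots(N+i_r)!} \] with $T_0(0)=1$ and $T_0(k)=0$ for $k\ge 1$.
   Context: For an integer $N\ge 1$ and a Dirichlet character $\chi$ of conductor $f$, the generalized hypergeometric Bernoulli numbers $B_{N,n,\chi}$ and polynomials $B_{N,n,\chi}(x)$ are defined by $\sum_{a=1}^f \frac{\chi(a)\, t^N e^{at}/N!}{e^{ft}-\sum_{m=0}^{N-1}\frac{(ft)^m}{m!}}=\sum_{n=0}^\infty B_{N,n,\chi}\frac{t^n}{n!}$ and $\sum_{a=1}^f \frac{\chi(a)\, t^N e^{(x+a)t}/N!}{e^{ft}-\sum_{m=0}^{N-1}\frac{(ft)^m}{m!}}=\sum_{n=0}^\infty B_{N,n,\chi}(x)\frac{t^n}{n!}$ for $|t|<2\pi/f$. Put $S_n:=\sum_{a=1}^f\chi(a)a^n$ and $S_n(x):=\sum_{a=1}^f\chi(a)(x+a)^n$. *)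

(* Defs.v *)
From HB Require Import structures.
From mathcomp Require Import all_boot all_order all_algebra.
From mathcomp Require Import all_classical all_reals all_analysis.
From mathcomp Require Import complex.

Set Implicit Arguments.
Unset Strict Implicit.
Unset Printing Implicit Defensive.

Import Order.TTheory GRing.Theory Num.Theory numFieldNormedType.Exports.

Local Open Scope classical_set_scope.
Local Open Scope ring_scope.
Local Open Scope complex_scope.

Section DirichletCharacters.
Variable R : realType.
Implicit Types (chi : int -> R[i]) (m d f : nat).

Record dirichlet_character m chi : Prop := DirichletCharacter {
  dirichlet_modulus_gt0 : (0 < m)%N ;
  dirichlet_periodic : forall a : int, chi (a + m%:Z) = chi a ;
  dirichlet1 : chi 1 = 1 ;
  dirichletM : forall a b : int, chi (a * b) = chi a * chi b ;
  dirichlet_neq0 : forall a : int, (chi a != 0) = coprimez a m%:Z }.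

(* For d %| m: chi restricted to (Z/m)^* factors through (Z/d)^*. *)
Definition induced_modulus m chi d : Prop :=
  forall a b : int, coprimez a m%:Z -> coprimez b m%:Z ->
    (a = b %[mod d%:Z])%Z -> chi a = chi b.

(* A primitive character of conductor f is the case m = f. *)
Definition is_conductor m chi f : Prop :=
  [/\ (f %| m)%N, induced_modulus m chi f
    & forall d, (d %| m)%N -> induced_modulus m chi d -> (f <= d)%N].

End DirichletCharacters.

Section HypergeometricBernoulli.
Variable R : realType.
Implicit Types (chi : int -> R[i]) (N f n k r : nat) (x t z : R[i]).

Definition expC z : R[i] :=
  (expR (complex.Re z))%:C * (cos (complex.Im z) +i* sin (complex.Im z)).

Definition genfun_denom N f t : R[i] :=
  expC (f%:R * t) - \sum_(0 <= m < N) (f%:R * t) ^+ m / m`!%:R.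

Definition bernoulli_genfun N f chi t : R[i] :=
  \sum_(1 <= a < f.+1)
    (chi a%:Z * t ^+ N * expC (a%:R * t) / N`!%:R) / genfun_denom N f t.

Definition bernoulli_poly_genfun N f chi x t : R[i] :=
  \sum_(1 <= a < f.+1)
    (chi a%:Z * t ^+ N * expC ((x + a%:R) * t) / N`!%:R) / genfun_denom N f t.

(* G t = \sum_n b n * t^n / n! on the disc |t| < rho. The centre is left out:
   the generating functions above have a removable singularity at 0, where the
   defining quotient reads 0 / 0. *)
Definition is_egf (b : nat -> R[i]) (G : R[i] -> R[i]) (rho : R) : Prop :=
  forall t, t != 0 -> `|t| < rho%:C ->
    series (fun n => b n * (t ^+ n / n`!%:R)) @ \oo --> (G t : R[i]^o).

Definition hypergeom_bernoulli_numbers N f chi (B : nat -> R[i]) : Prop :=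
  is_egf B (bernoulli_genfun N f chi) (2 * pi / f%:R).

Definition hypergeom_bernoulli_polys N f chi (BX : nat -> R[i] -> R[i]) : Prop :=
  forall x, is_egf (BX ^~ x) (bernoulli_poly_genfun N f chi x) (2 * pi / f%:R).

Definition power_sum f chi n : R[i] :=
  \sum_(1 <= a < f.+1) chi a%:Z * a%:R ^+ n.

Definition power_sum_poly f chi n x : R[i] :=
  \sum_(1 <= a < f.+1) chi a%:Z * (x + a%:R) ^+ n.

(* The parts of a composition of k are at most k, hence the type 'I_k.+1.
   For r = 0 the only index is the empty function, so Tcoef N 0 k is 1 for
   k = 0 and 0 otherwise. *)
Definition Tcoef N r k : R[i] :=
  (- N`!%:R) ^+ r *
  \sum_(i : {ffun 'I_r -> 'I_k.+1}
         | ((\sum_(j < r) i j)%N == k) && [forall j, (1 <= i j)%N])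
    (\prod_(j < r) (N + i j)`!%:R)^-1.

End HypergeometricBernoulli.

(* Main.v *)
(** Restrict the generating functions to real [t = s > 0] and compare Taylor
    expansions as [s] tends to [0]. Multiplying the defining quotient by its
    denominator [(f s)^N * \sum_k (f s)^k / (N+k)!] and comparing coefficients
    shows that [B_n / n!] times this series is the exponential generating
    function of the power sums, divided by [N!]. Up to the factor
    [(f s)^N / N!], the denominator is [1 - v] with
    [v = - \sum_(i >= 1) N! (f s)^i / (N+i)!], and the coefficient of [s^k] in
    [v^r] is [f^k T_r(k)], so the geometric series [\sum_r v^r] inverts it. *)

Require Import Defs.
From HB Require Import structures.
From mathcomp Require Import all_boot all_order all_algebra.
From mathcomp Require Import all_classical all_reals all_analysis.
From mathcomp Require Import complex ring lra.

Import Order.TTheory GRing.Theory Num.Theory numFieldNormedType.Exports.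

Local Open Scope ring_scope.
Local Open Scope complex_scope.

Set Implicit Arguments.
Unset Strict Implicit.

Lemma natf_fact_neq0 (F : numFieldType) (n : nat) : n`!%:R != 0 :> F.
Proof. by rewrite pnatr_eq0 -lt0n fact_gt0. Qed.

(** * Polynomials modulo [X^n] *)

Definition eqmodXn (K : comNzRingType) (n : nat) (p q : {poly K}) : Prop :=
  forall i, (i < n)%N -> p`_i = q`_i.

Lemma eqmodXnM (K : comNzRingType) (n : nat) (p p' q q' : {poly K}) :
  eqmodXn n p p' -> eqmodXn n q q' -> eqmodXn n (p * q) (p' * q').
Proof.
move=> pp qq i i_n; rewrite !coefM; apply: eq_bigr => -[j] /= j_i _.
by rewrite pp ?qq //; [apply: leq_ltn_trans i_n; apply: leq_subr
  | apply: leq_ltn_trans i_n].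
Qed.

Lemma eqmodXnMl (K : comNzRingType) (n : nat) (p q q' : {poly K}) :
  eqmodXn n q q' -> eqmodXn n (p * q) (p * q').
Proof. exact: eqmodXnM. Qed.

Lemma eqmodXn_exp (K : comNzRingType) (n r : nat) (p q : {poly K}) :
  eqmodXn n p q -> eqmodXn n (p ^+ r) (q ^+ r).
Proof.
by move=> pq; elim: r => // r IH; rewrite !exprS; apply: eqmodXnM.
Qed.

(** Distributing the product of [r] equal factors over their sums gives one monomial for each choice
    function [i], of degree the sum of its values. *)
Lemma coef_poly_exp (K : comNzRingType) (n r k : nat) (c : nat -> K) :
  ((\poly_(i < n) c i) ^+ r)`_k =
  \sum_(i : {ffun 'I_r -> 'I_n} | (\sum_(j < r) i j)%N == k)
    \prod_(j < r) c (i j).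
Proof.
rewrite poly_def -[X in _ ^+ X]card_ord -prodr_const bigA_distr_bigA /= coef_sum.
rewrite [RHS]big_mkcond /=; apply: eq_bigr => i _.
rewrite (eq_bigr (fun j => (c (i j))%:P * 'X^(i j))); last first.
  by move=> j _; rewrite mul_polyC.
rewrite big_split /= -rmorph_prod /= coefCM -(big_morph _ (exprD 'X) (expr0 'X)).
by rewrite coefXn eq_sym; case: ifP => _; rewrite ?mulr1 ?mulr0.
Qed.

(** * Compositions with positive parts and formal inversion of the denominator *)

Section RestrictedCompositions.
Variables (R : realType) (N : nat) (z : R[i]).

(** Coefficients of [v], with [z] in the role of [f]. The zero at index 0 is what restricts powers
    of [v] to compositions with parts at least 1. *)
Definition comp_step (i : nat) : R[i] :=
  if i == 0%N then 0 else - N`!%:R * z ^+ i / (N + i)`!%:R.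

Lemma coef_comp_step_exp (n r k : nat) : (k < n)%N ->
  ((\poly_(i < n) comp_step i) ^+ r)`_k = z ^+ k * Tcoef R N r k.
Proof.
(* The coefficient of [X^k] sees only the terms up to degree [k]; truncating at [k.+1] matches the
   index type in [Tcoef]. *)
move=> k_n; have -> : ((\poly_(i < n) comp_step i) ^+ r)`_k =
    ((\poly_(i < k.+1) comp_step i) ^+ r)`_k.
  apply: (@eqmodXn_exp _ k.+1) => // i i_k; rewrite !coef_poly i_k.
  by rewrite (leq_trans i_k k_n).
rewrite coef_poly_exp /Tcoef mulrCA mulr_sumr mulr_sumr.
rewrite [RHS]big_mkcondr /=; apply: eq_bigr => i /eqP sum_i.
(* A function with a zero part contributes a product containing [comp_step 0 = 0]. *)
case: forallP => [i_gt0|/forallP]; last first.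
  rewrite negb_forall => /existsP[j]; rewrite -eqn0Ngt => /eqP ij0.
  by rewrite (bigD1 j) //= /comp_step ij0 mul0r.
rewrite (eq_bigr (fun j => - N`!%:R * z ^+ (i j) * ((N + i j)`!%:R)^-1));
  last by move=> j _; rewrite /comp_step -leqn0 leqNgt i_gt0.
rewrite !big_split /= prodr_const card_ord prodfV -mulrA; congr (_ * (_ * _)).
by rewrite -(big_morph _ (exprD z) (expr0 z)) sum_i.
Qed.

(** The sum is empty, since [r] parts that are each at least 1 add up to at least [r]. *)
Lemma Tcoef_small (r k : nat) : (k < r)%N -> Tcoef R N r k = 0.
Proof.
move=> k_r; rewrite /Tcoef big_pred0 ?mulr0 // => i.
apply/negP => /andP[/eqP sum_i /forallP i_gt0].
have : (\sum_(j < r) 1 <= \sum_(j < r) i j)%N by apply: leq_sum => j _.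
by rewrite sum1_card card_ord sum_i leqNgt k_r.
Qed.

(** The coefficients of [\sum_r v^r], which inverts [1 - v], for
    [v = \sum_i comp_step i X^i]. *)
Lemma Tcoef_geometric (n : nat) :
  eqmodXn n ((1 - \poly_(i < n) comp_step i) *
    \poly_(k < n) (z ^+ k * \sum_(0 <= r < k.+1) Tcoef R N r k)) 1.
Proof.
set v := \poly_(i < n) comp_step i.
(* As [v] has no constant term, [v^r] contributes nothing to [X^k] for [r > k], so the sum over
   [r < n] can be cut after [r = k]. *)
have geomE : eqmodXn n (\sum_(r < n) v ^+ r)
    (\poly_(k < n) (z ^+ k * \sum_(0 <= r < k.+1) Tcoef R N r k)).
  move=> k k_n; rewrite coef_poly k_n coef_sum.
  under eq_bigr do rewrite coef_comp_step_exp //.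
  rewrite -mulr_sumr -(big_mkord xpredT (fun r => Tcoef R N r k)).
  rewrite (big_cat_nat (n := k.+1)) //= [X in _ + X]big_nat_cond.
  rewrite [X in _ + X]big1 ?addr0 // => r /andP[/andP[k_r _] _].
  exact: Tcoef_small.
move=> k k_n; transitivity (((1 - v) * \sum_(r < n) v ^+ r)`_k).
  by apply/esym; exact: (eqmodXnMl _ geomE k_n).
(* The product telescopes to [1 - v^n], and [v^n] has no coefficient below degree [n]. *)
rewrite -opprB mulNr -subrX1 opprB coefB coef_comp_step_exp //.
by rewrite Tcoef_small // mulr0 subr0.
Qed.

(** The hypothesis is a Cauchy product of [b] with the denominator series stripped of its power of
    the variable. Multiplying it by [N! / z^N] turns that series into [1 - v], which
    [Tcoef_geometric] inverts. *)
Lemma hypergeom_bernoulli_inversion (n : nat) (b c : nat -> R[i]) : z != 0 ->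
  (forall j, (j <= n)%N ->
     \sum_(k < j.+1) b k * (z ^+ (N + (j - k)) / (N + (j - k))`!%:R) =
     c j / N`!%:R) ->
  b n = \sum_(0 <= k < n.+1)
     z ^+ k / z ^+ N * (\sum_(0 <= r < k.+1) Tcoef R N r k) * c (n - k)%N.
Proof.
move=> z0 bc; pose M := n.+1.
pose A := \poly_(k < M) (z ^+ k * \sum_(0 <= r < k.+1) Tcoef R N r k).
pose v := \poly_(i < M) comp_step i.
pose pb := \poly_(k < M) b k; pose pc := \poly_(k < M) c k.
have N0 : N`!%:R != 0 :> R[i] := natf_fact_neq0 _ N.
have key : eqmodXn M (pb * (1 - v)) ((z ^+ N)^-1 *: pc).
  move=> j j_n; rewrite coefZ coef_poly j_n -[c j](divfK N0) -bc //.
  rewrite mulr_suml mulr_sumr coefM; apply: eq_bigr => -[k k_j] _ /=.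
  rewrite coef_poly (leq_trans k_j) // coefB coef1 coef_poly.
  rewrite (leq_ltn_trans (leq_subr _ _) j_n) /comp_step [RHS]mulrC -!mulrA.
  congr (_ * _); case: ((j - k)%N =P 0%N) => [->|_].
    by rewrite addn0 subr0 mulKf // mulfV // expf_neq0.
  rewrite sub0r !mulNr opprK exprD [RHS]mulrC -!mulrA.
  by rewrite mulKf ?expf_neq0 // [RHS]mulrC -mulrA.
(* Replace 1 by [(1 - v) * A] modulo [X^M], then [pb * (1 - v)] by the right side of [key]. *)
have -> : b n = (pb * 1)`_n by rewrite mulr1 coef_poly ltnSn.
have := eqmodXnMl pb (@Tcoef_geometric M).
move=> /(_ n (ltnSn n)) <-; rewrite mulrA mulrC.
rewrite (eqmodXnMl A key) // -scalerAr coefZ coefM mulr_sumr big_mkord.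
apply: eq_bigr => -[k k_n] _ /=.
rewrite !coef_poly k_n ltnS leq_subr !mulrA; congr (_ * _ * _).
by rewrite mulrC.
Qed.

End RestrictedCompositions.

(** * Asymptotic expansions in a real variable tending to 0 from above *)

Section Approximation.
Local Open Scope classical_set_scope.
Variable R : realType.
Implicit Types (g : R -> R[i]) (p q : {poly R[i]}) (s : R) (n : nat).

(** [g s = p s + O(s^n)] as the real variable [s] tends to [0] from above. *)
Definition approx n g p : Prop :=
  exists C : R, \forall s \near 0^'+, `|g s - p.[s%:C]| <= (C * s ^+ n)%:C.

Lemma norm_RtoC (x : R) : 0 <= x -> `|x%:C| = x%:C.
Proof. by move=> x0; rewrite ger0_norm // ler0c. Qed.

Lemma horner_bounded p :
  exists2 C : R, 0 <= C & forall s, 0 <= s <= 1 -> `|p.[s%:C]| <= C%:C.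
Proof.
(* The norm on [R[i]] takes values in [R[i]]; [complex.Re] brings it back to [R]. *)
exists (\sum_(i < size p) complex.Re `|p`_i|) => [|s /andP[s0 s1]].
  by apply: sumr_ge0 => i _; rewrite normc_def /= sqrtr_ge0.
rewrite horner_coef (le_trans (ler_norm_sum _ _ _)) // rmorph_sum.
apply: ler_sum => i _; rewrite normrM normrX norm_RtoC //.
rewrite -[leRHS]/((complex.Re _)%:C) RRe_real ?normr_real //.
rewrite ler_piMr // -rmorphXn -(rmorph1 (real_complex R)).
by rewrite lecR exprn_ile1.
Qed.

Lemma approx_poly n p : approx n (fun s => p.[s%:C]) p.
Proof.
by exists 0; near=> s; rewrite subrr normr0 mul0r.
Unshelve. all: by end_near. Qed.

Lemma approxD n g h p q :
  approx n g p -> approx n h q -> approx n (fun s => g s + h s) (p + q).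
Proof.
move=> [C gp] [D hq]; exists (C + D); near=> s.
rewrite hornerD opprD addrACA (le_trans (ler_normD _ _)) // mulrDl rmorphD /=.
by apply: lerD; near: s.
Unshelve. all: by end_near. Qed.

Lemma approxM n g h p q :
  approx n g p -> approx n h q -> approx n (fun s => g s * h s) (p * q).
Proof.
move=> [C gp] [D hq].
have [P P0 pP] := horner_bounded p; have [Q Q0 qQ] := horner_bounded q.
(* The constant comes from [g h - p q = (g - p) h + p (h - q)], where [|h|] is at most [|D| + Q]
   because [s^n <= 1]. *)
exists (`|C| * (`|D| + Q) + P * `|D|); near=> s.
have s0 : 0 < s by near: s; exact: nbhs_right_gt.
have s1 : s <= 1 by near: s; exact: nbhs_right_le.
have s01 : 0 <= s <= 1 by rewrite ltW.
have sn1 : s ^+ n <= 1 by rewrite exprn_ile1 // ltW.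
have sn0 : 0 <= s ^+ n by rewrite exprn_ge0 // ltW.
have gps : `|g s - p.[s%:C]| <= (`|C| * s ^+ n)%:C.
  apply: (@le_trans _ _ (C * s ^+ n)%:C); first by near: s.
  by rewrite lecR ler_wpM2r // ler_norm.
have hqs : `|h s - q.[s%:C]| <= (`|D| * s ^+ n)%:C.
  apply: (@le_trans _ _ (D * s ^+ n)%:C); first by near: s.
  by rewrite lecR ler_wpM2r // ler_norm.
have hs : `|h s| <= (`|D| + Q)%:C.
  rewrite -[h s](subrK q.[s%:C]) (le_trans (ler_normD _ _)) // rmorphD /=.
  apply: lerD; last exact: qQ.
  by apply: le_trans hqs _; rewrite lecR ler_piMr.
have -> : g s * h s - (p * q).[s%:C] =
    (g s - p.[s%:C]) * h s + p.[s%:C] * (h s - q.[s%:C]).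
  by rewrite hornerM mulrBl mulrBr addrA subrK.
have <- : (`|C| * s ^+ n)%:C * (`|D| + Q)%:C + P%:C * (`|D| * s ^+ n)%:C =
    ((`|C| * (`|D| + Q) + P * `|D|) * s ^+ n)%:C.
  by rewrite -!rmorphM -rmorphD mulrAC mulrA -mulrDl.
by rewrite (le_trans (ler_normD _ _)) // !normrM lerD // ler_pM // pP.
Unshelve. all: by end_near. Qed.

Lemma approx_sum n (I : Type) (r : seq I) (g : I -> R -> R[i])
    (p : I -> {poly R[i]}) :
  (forall i, approx n (g i) (p i)) ->
  approx n (fun s => \sum_(i <- r) g i s) (\sum_(i <- r) p i).
Proof.
move=> gp; elim: r => [|i r IH].
  under eq_fun do rewrite big_nil; rewrite big_nil.
  by have := approx_poly n 0; under eq_fun do rewrite horner0.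
under eq_fun do rewrite big_cons; rewrite big_cons.
exact: approxD.
Qed.

Lemma approx_eq_near n g h p :
  (\forall s \near 0^'+, g s = h s) -> approx n g p -> approx n h p.
Proof.
move=> gh [C gp]; exists C; near=> s.
have <- : g s = h s by near: s.
by near: s.
Unshelve. all: by end_near. Qed.

(** The difference [p - q] is [X^n] times a polynomial that is bounded on the unit interval. *)
Lemma approx_eqmodXn n g p q : eqmodXn n p q -> approx n g p -> approx n g q.
Proof.
move=> pq [C gp]; have [D D0 dD] := horner_bounded (drop_poly n (p - q)).
exists (C + D); near=> s.
have s0 : 0 < s by near: s; exact: nbhs_right_gt.
have s1 : s <= 1 by near: s; exact: nbhs_right_le.
have -> : g s - q.[s%:C] = (g s - p.[s%:C]) + (p - q).[s%:C].
  by rewrite hornerD hornerN addrA subrK.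
rewrite (le_trans (ler_normD _ _)) // mulrDl rmorphD /=; apply: lerD.
  by near: s.
rewrite -(poly_take_drop n (p - q)) (_ : take_poly n _ = 0) ?add0r; last first.
  apply/polyP => i; rewrite coef_take_poly coef0; case: ltnP => // i_n.
  by rewrite coefB pq // subrr.
rewrite hornerM hornerXn normrM normrX norm_RtoC ?(ltW s0) // rmorphM rmorphXn.
by apply: ler_wpM2r; [rewrite exprn_ge0 // ler0c ltW|rewrite dD // ltW].
Unshelve. all: by end_near. Qed.

(** Uniqueness of the expansion, by strong induction on the degree: once the lower coefficients of
    [r = p - q] vanish, [r_i s^i = O(s^(i+1))], so [r_i = O(s)] and the constant [r_i] is 0. *)
Lemma approx_inj n g p q : approx n g p -> approx n g q -> eqmodXn n p q.
Proof.
move=> [C gp] [D gq]; elim/ltn_ind => i IH i_n.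
pose r := p - q.
have [E E0 rE] := horner_bounded (drop_poly i.+1 r).
have ri : \forall s \near 0^'+, `|r`_i| <= ((`|C + D| + E) * s)%:C.
  near=> s.
  have s0 : 0 < s by near: s; exact: nbhs_right_gt.
  have s1 : s <= 1 by near: s; exact: nbhs_right_le.
  have rs : `|r.[s%:C]| <= (`|C + D| * s ^+ i.+1)%:C.
    have -> : r.[s%:C] = (g s - q.[s%:C]) - (g s - p.[s%:C]).
      by rewrite /r hornerD hornerN opprB [RHS]addrC addrA subrK.
    apply: (@le_trans _ _ ((C + D) * s ^+ n)%:C).
      rewrite (le_trans (ler_normB _ _)) // addrC mulrDl rmorphD /=.
      by apply: lerD; near: s.
    rewrite lecR (@le_trans _ _ (`|C + D| * s ^+ n)) //.
      by rewrite ler_wpM2r ?ler_norm // exprn_ge0 // ltW.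
    by rewrite ler_wpM2l // ler_wiXn2l // ltW.
  have rE' : r`_i * s%:C ^+ i =
      r.[s%:C] - (drop_poly i.+1 r).[s%:C] * s%:C ^+ i.+1.
    rewrite -{2}(poly_take_drop i.+1 r) hornerD hornerM hornerXn addrK.
    (* By the induction hypothesis only the top term of this truncation survives. *)
    rewrite (_ : take_poly i.+1 r = r`_i *: 'X^i) ?hornerZ ?hornerXn //.
    apply/polyP => j; rewrite coef_take_poly coefZ coefXn ltnS leq_eqVlt.
    case: eqP => [->|_] /=; first by rewrite mulr1.
    by rewrite mulr0; case: ifP => // j_i; rewrite coefB IH ?subrr //
      (ltn_trans j_i).
  have si0 : 0 < (s ^+ i)%:C by rewrite ltcR exprn_gt0.
  rewrite -(ler_pM2r si0) -[in leLHS](norm_RtoC (ltW _)) ?exprn_gt0 //.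
  rewrite -normrM rmorphXn rE' (le_trans (ler_normB _ _)) //.
  rewrite -rmorphXn -rmorphM -mulrA -exprS mulrDl rmorphD; apply: lerD => //.
  rewrite normrM normrX norm_RtoC ?(ltW s0) // rmorphM rmorphXn.
  by apply: ler_wpM2r; [rewrite exprn_ge0 // ler0c ltW|rewrite rE // ltW].
suff : r`_i = 0 by move/eqP; rewrite coefB subr_eq0 => /eqP.
apply/eqP; rewrite -normr_le0; apply/ler_addgt0Pr => e e0; rewrite add0r.
(* The added 1 makes the constant strictly positive, so [Re e] can be divided by it to bound [s]. *)
have K0 : 0 < `|C + D| + E + 1 by rewrite ltr_pwDr // addr_ge0.
have eE : e = (complex.Re e)%:C by rewrite RRe_real // gtr0_real.
have e0' : 0 < complex.Re e by rewrite -ltcR -eE.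
have : \forall s \near (0 : R)^'+, `|r`_i| <= e.
  near=> s.
  have s0 : 0 < s by near: s; exact: nbhs_right_gt.
  apply: (@le_trans _ _ ((`|C + D| + E) * s)%:C); first by near: s.
  rewrite eE lecR (@le_trans _ _ ((`|C + D| + E + 1) * s)) //.
    by rewrite ler_wpM2r ?(ltW s0) // lerDl.
  rewrite mulrC -ler_pdivlMr //; near: s; apply: nbhs_right_le.
  by rewrite divr_gt0.
by move=> /filter_ex[].
Unshelve. all: by end_near. Qed.

End Approximation.

(** * Convergent power series as asymptotic expansions *)

Section PowerSeries.
Variable R : realType.
Local Open Scope classical_set_scope.

Lemma geometric_tail (q : R) (n d : nat) : 0 <= q <= 2^-1 ->
  \sum_(n <= k < n + d) q ^+ k <= 2 * q ^+ n.
Proof.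
(* The sharper bound makes the induction close: for [q <= 1/2], [q^k <= 2 q^k - 2 q^(k+1)]. *)
move=> /andP[q0 q2]; apply: (@le_trans _ _ (2 * q ^+ n - 2 * q ^+ (n + d))).
  elim: d => [|d IH]; first by rewrite addn0 big_geq // subrr.
  rewrite addnS big_nat_recr ?leq_addr //= (le_trans (lerD IH (lexx _))) //.
  have := ler_wpM2r (exprn_ge0 (n + d) q0) q2.
  by rewrite exprS; lra.
by rewrite gerBl mulr_ge0 // exprn_ge0.
Qed.

Lemma series_cvg_bounded (K : numFieldType) (u : nat -> K) (l : K) :
  series u @ \oo --> (l : K^o) -> bounded_fun (u : nat -> K^o).
Proof.
move=> ul; apply: cvg_seq_bounded; apply: (cvgP (0 : K^o)).
by apply: (@cvg_series_cvg_0 K K^o u); exact: cvgP ul.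
Qed.

Lemma cvgr_dist (K : numFieldType) (u : nat -> K) (l : K) :
  u @ \oo --> (l : K^o) <->
  forall e, 0 < e -> \forall m \near \oo, `|l - u m| < e.
Proof. exact: (@cvgrPdist_lt K K^o). Qed.

(** Convergence at [t = rho / 2] bounds all [|c k| t^k] by one [M]. For [s <= t / 2] the tail from
    [n] on is dominated by a geometric series of ratio [s / t <= 1/2], hence by [2 M (s / t)^n]. *)
Lemma approx_power_series (c : nat -> R[i]) (g : R -> R[i]) (rho : R) (n : nat) :
  0 < rho ->
  (forall s, 0 < s < rho ->
     series (fun k => c k * s%:C ^+ k) @ \oo --> (g s : R[i]^o)) ->
  approx n g (\poly_(k < n) c k).
Proof.
move=> rho0 cg; pose t := rho / 2.
have t0 : 0 < t by rewrite divr_gt0.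
have trho : t < rho by rewrite ltr_pdivrMr // mulr_natr mulr2n ltrDl.
have [M M0 cM] : exists2 M : R, 0 <= M & forall k, `|c k| * (t ^+ k)%:C <= M%:C.
  have t_rho : 0 < t < rho by rewrite t0.
  have := series_cvg_bounded (cg t t_rho).
  case=> A [Areal /(_ (`|A| + 1))].
  have -> : A < `|A| + 1.
    by apply: le_lt_trans (real_ler_norm Areal) _; rewrite ltrDl.
  move=> /(_ isT) bnd; exists (complex.Re (`|A| + 1)).
    by rewrite -lecR RRe_real ?addr_ge0 // realD // ?normr_real ?real1.
  move=> k; rewrite RRe_real; last by rewrite realD // ?normr_real ?real1.
  have : `|c k * t%:C ^+ k| <= `|A| + 1 by exact: bnd k I.
  rewrite normrM normrX norm_RtoC ?(ltW t0) //.
  by rewrite rmorphXn.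
exists (2 * M / t ^+ n); near=> s.
have s0 : 0 < s by near: s; exact: nbhs_right_gt.
have st : s <= t / 2 by near: s; apply: nbhs_right_le; rewrite divr_gt0.
have s_rho : s < rho.
  apply: le_lt_trans st (le_lt_trans _ trho).
  by rewrite ler_pdivrMr // ler_peMr ?(ltW t0) // ler1n.
have s0_rho : 0 < s < rho by rewrite s0.
have cgs := (cvgr_dist _ _).1 (cg s s0_rho).
(* The tail bound is uniform over partial sums; a partial sum within [e] of the limit transfers it
   to [g s]. *)
apply/ler_addgt0Pr => e e0.
have [m _ /(_ (m + n)%N (leq_addr _ _)) /= mP] := cgs e e0.
set P := _.[_]; pose S := series (fun k => c k * s%:C ^+ k) (m + n)%N.
have -> : g s - P = (S - P) + (g s - S) by rewrite [RHS]addrC addrA subrK.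
rewrite (le_trans (ler_normD _ _)) // lerD // ?(ltW mP) //.
rewrite /S /P {S P mP} /series /= (big_cat_nat (n := n)) //= ?leq_addl //.
rewrite horner_poly big_mkord addrAC subrr add0r.
rewrite (le_trans (ler_norm_sum _ _ _)) //.
pose q := s / t.
have q01 : 0 <= q <= 2^-1.
  by rewrite /q divr_ge0 ?(ltW s0) ?(ltW t0) //= ler_pdivrMr // mulrC.
have -> : 2 * M / t ^+ n * s ^+ n = M * (2 * q ^+ n).
  by rewrite /q (expr_div_n s) -!mulrA mulrCA; congr (_ * (_ * _)); rewrite mulrC.
apply: (@le_trans _ _ (M * \sum_(n <= k < m + n) q ^+ k)%:C); last first.
  by rewrite lecR ler_wpM2l // [in leLHS]addnC geometric_tail.
rewrite mulr_sumr rmorph_sum; apply: ler_sum => k _.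
rewrite normrM normrX norm_RtoC ?(ltW s0) // -rmorphXn.
rewrite (_ : s ^+ k = t ^+ k * q ^+ k); last first.
  by rewrite -exprMn /q mulrCA mulfV ?mulr1 // gt_eqF.
rewrite !rmorphM /= mulrA; apply: ler_wpM2r; last exact: cM.
by rewrite ler0c exprn_ge0 //; case/andP: q01.
Unshelve. all: by end_near. Qed.

Lemma cvg_complex (u v : nat -> R) (a b : R) :
  u @ \oo --> a -> v @ \oo --> b ->
  (fun n => u n +i* v n) @ \oo --> ((a +i* b) : R[i]^o).
Proof.
move=> /cvgrPdist_lt ua /cvgrPdist_lt vb; apply/cvgr_dist => e e0.
have eE : e = (complex.Re e)%:C by rewrite RRe_real // gtr0_real.
have e0' : 0 < complex.Re e / 2 by rewrite divr_gt0 // -ltcR -eE.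
near=> n.
have -> : (a +i* b) - (u n +i* v n) = (a - u n)%:C + 'i * (b - v n)%:C.
  by rewrite [LHS]complexE.
rewrite (le_lt_trans (ler_normD _ _)) // eE [complex.Re e]splitr.
have normi : `|'i : R[i]| = 1 by rewrite normc_def /= expr0n add0r expr1n sqrtr1.
have normR (x : R) : `|x%:C| = `|x|%:C.
  by rewrite normc_def /= expr0n addr0 sqrtr_sqr.
rewrite normrM normi mul1r !normR -rmorphD ltcR; apply: ltrD.
  by near: n; exact: ua.
by near: n; exact: vb.
Unshelve. all: by end_near. Qed.

End PowerSeries.

(** * Expansions of the complex exponential and of the denominator *)

Section ComplexExponential.
Variable R : realType.
Local Open Scope classical_set_scope.

Definition exp_poly (n : nat) (w : R[i]) : {poly R[i]} :=
  \poly_(k < n) (w ^+ k / k`!%:R).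

(** The addition law of the exponential on truncated series, which is the binomial theorem in each
    degree. *)
Lemma exp_polyD (n : nat) (w z : R[i]) :
  eqmodXn n (exp_poly n w * exp_poly n z) (exp_poly n (w + z)).
Proof.
move=> i i_n; rewrite coefM !coef_poly i_n [w + z]addrC exprDn mulr_suml.
apply: eq_bigr => -[j] /= j_i _; rewrite !coef_poly.
rewrite (leq_trans j_i) // (leq_ltn_trans (leq_subr _ _)) //.
rewrite -(bin_fact (n := i) (m := j)) // !natrM -[z ^+ _ * _ *+ _]mulr_natr.
have C0 : 'C(i, j)%:R != 0 :> R[i] by rewrite pnatr_eq0 -lt0n bin_gt0.
by rewrite invfM [RHS]mulrA mulfK // invfM mulrACA (mulrC (w ^+ j)).
Qed.

Lemma approx_expR (n : nat) (a : R) :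
  approx n (fun s => (expR (a * s))%:C) (exp_poly n a%:C).
Proof.
(* The series converges everywhere, so the radius 1 is an arbitrary choice. *)
apply: (@approx_power_series _ _ _ 1) => // s _.
rewrite (_ : series _ = fun m => series (exp_coeff (a * s)) m +i* 0).
  exact: (cvg_complex (is_cvg_series_exp_coeff (a * s)) (cvg_cst 0)).
apply/funext => m; rewrite -[RHS]/((series (exp_coeff (a * s)) m)%:C).
rewrite /series /= rmorph_sum; apply: eq_bigr => k _.
by rewrite /exp_coeff /= exprMn !rmorphM /= !rmorphXn fmorphV /= rmorph_nat mulrAC.
Qed.

(** Euler's formula term by term: the series of cosine and sine interleave into that of the
    exponential at ['i * b]. *)
Lemma approx_cos_sin (n : nat) (b : R) :
  approx n (fun s => cos (b * s) +i* sin (b * s)) (exp_poly n ('i * b%:C)).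
Proof.
apply: (@approx_power_series _ _ _ 1) => // s _.
have -> : cos (b * s) +i* sin (b * s) =
    limn (series (cos_coeff (b * s))) +i* limn (series (sin_coeff (b * s))).
  by rewrite cos.unlock sin.unlock.
rewrite (_ : series _ = fun m =>
    series (cos_coeff (b * s)) m +i* series (sin_coeff (b * s)) m).
  by apply: cvg_complex;
    [exact: is_cvg_series_cos_coeff | exact: is_cvg_series_sin_coeff].
apply/funext => m; rewrite [RHS]complexE /= /series /= !rmorph_sum mulr_sumr.
rewrite -big_split /=; apply: eq_bigr => k _; rewrite /cos_coeff /sin_coeff /=.
have -> : ('i * b%:C) ^+ k / k`!%:R * s%:C ^+ k =
    'i ^+ k * ((b * s) ^+ k / k`!%:R)%:C.
  rewrite rmorphM fmorphV rmorph_nat rmorphXn rmorphM !exprMn -!mulrA.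
  by rewrite [s%:C ^+ k * _]mulrC.
rewrite -exprnP -!(mulrA (_ * _) (_ ^+ k)) !rmorphM !mulrA -!mulrDl.
congr (_ * _ * _); rewrite !rmorph_nat !rmorphXn !rmorphN1.
(* Since [i^k = i^(odd k) (-1)^(k./2)], even [k] matches the cosine and odd [k] the sine. *)
rewrite -{1}(odd_double_half k) exprD -mul2n exprM sqr_i.
case: (boolP (odd k)) => k_odd /=; last by rewrite expr0 mulr0 mul0r addr0.
rewrite mul0r add0r mulr1; case: k k_odd => //= k /negPf k_even.
by rewrite uphalf_half k_even.
Qed.

(** The factors for the real and imaginary parts of [w] recombine by [exp_polyD]. *)
Lemma approx_expC (n : nat) (w : R[i]) :
  approx n (fun s => expC (w * s%:C)) (exp_poly n w).
Proof.
have h := approxM (approx_expR n (complex.Re w)) (approx_cos_sin n (complex.Im w)).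
have := approx_eqmodXn (@exp_polyD _ _ _) h; rewrite -complexE.
apply: approx_eq_near; near=> s; rewrite /expC; case: w h => x y _ /=.
by rewrite !mulr0 subr0 add0r.
Unshelve. all: by end_near. Qed.

Lemma expC_RtoC (x : R) : expC x%:C = (expR x)%:C.
Proof. by rewrite /expC /= cos0 sin0 mulr1. Qed.

Lemma expR_gt_partial_sum (N : nat) (x : R) : 0 < x ->
  \sum_(0 <= k < N) x ^+ k / k`!%:R < expR x.
Proof.
(* One more term of the series, which is positive, makes the inequality strict. *)
move=> x0; apply: (@lt_le_trans _ _ (series (exp_coeff x) N.+1)).
  by rewrite /series /= big_nat_recr //= ltrDl /exp_coeff /= divr_gt0 ?exprn_gt0.
apply: nondecreasing_cvgn_le; last exact: is_cvg_series_exp_coeff.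
by apply: nondecreasing_series => k _ _; rewrite exp_coeff_ge0 // ltW.
Qed.

(** Allows the defining quotient to be multiplied out at [s > 0]: there the denominator is a real
    exponential minus one of its partial sums. *)
Lemma genfun_denom_neq0 (N f : nat) (s : R) : (0 < f)%N -> 0 < s ->
  genfun_denom N f s%:C != 0.
Proof.
move=> f0 s0; have fs0 : 0 < f%:R * s by rewrite mulr_gt0 ?ltr0n.
rewrite /genfun_denom -(rmorph_nat (real_complex R)) -rmorphM expC_RtoC.
rewrite (eq_bigr (fun k => ((f%:R * s) ^+ k / k`!%:R)%:C)); last first.
  by move=> k _; rewrite [RHS]rmorphM fmorphV rmorphXn rmorph_nat.
rewrite -rmorph_sum subr_eq0 eq_sym lt_eqF // ltcR.
exact: expR_gt_partial_sum.
Qed.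

(** The subtracted sum removes the terms below degree [N]. The order [n + N] leaves [n] coefficients
    after the factor [X^N] is cancelled. *)
Lemma approx_genfun_denom (n N f : nat) :
  approx (n + N) (fun s : R => genfun_denom N f s%:C)
    ((\poly_(k < n) (f%:R ^+ (N + k) / (N + k)`!%:R)) * 'X^N).
Proof.
have hN := approx_poly (n + N) (- exp_poly N (f%:R : R[i])).
have hD := approxD (approx_expC (n + N) (f%:R : R[i])) hN.
apply: approx_eqmodXn (approx_eq_near _ hD) => [i i_n|].
  rewrite coefB coefMXn !coef_poly i_n; case: ltnP => iN; first by rewrite subrr.
  by rewrite subr0 subnKC // ltn_subLR // addnC i_n.
near=> s; rewrite /genfun_denom hornerN; congr (_ - _).
rewrite horner_poly big_mkord; apply: eq_bigr => k _.
by rewrite exprMn mulrAC.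
Unshelve. all: by end_near. Qed.

End ComplexExponential.

(** * Comparison of coefficients in the generating functions *)

Section GeneratingFunctionCoefficients.
Variable R : realType.
Local Open Scope classical_set_scope.

Lemma bernoulli_poly_coef (N f : nat) (chi : int -> R[i])
    (b : nat -> R[i]) (x : R[i]) (n : nat) : (0 < f)%N ->
  is_egf b (bernoulli_poly_genfun N f chi x) (2 * pi / f%:R) ->
  b n = \sum_(0 <= k < n.+1)
          k`!%:R / f%:R ^ (N%:Z - k%:Z) * 'C(n, k)%:R
          * (\sum_(0 <= r < k.+1) Tcoef R N r k) * power_sum_poly f chi (n - k) x.
Proof.
move=> f0 bG; have fC0 : f%:R != 0 :> R[i] by rewrite pnatr_eq0 -lt0n.
have n0 m : m`!%:R != 0 :> R[i] := natf_fact_neq0 _ m.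
pose M := (n.+1 + N)%N; pose c k := b k / k`!%:R.
have rho0 : 0 < 2 * pi / f%:R :> R by rewrite divr_gt0 ?mulr_gt0 ?pi_gt0 ?ltr0n.
have approxG : approx M
    (fun s => bernoulli_poly_genfun N f chi x s%:C) (\poly_(k < M) c k).
  apply: (@approx_power_series R c _ _ M rho0) => s /andP[s0 s_rho].
  rewrite (_ : (fun k => _) = fun k => b k * (s%:C ^+ k / k`!%:R)).
    by apply: bG; [rewrite gt_eqF // ltcR|rewrite norm_RtoC ?ltcR // ltW].
  by apply/funext => k; rewrite /c mulrAC mulrA.
(* [E] expands the numerator without its factor [t^N]; its coefficients are the power sums divided
   by [N!] and a factorial. *)
pose E := \sum_(1 <= a < f.+1) (chi a%:Z / N`!%:R) *: exp_poly M (x + a%:R).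
have approxE : approx M
    (fun s => \sum_(1 <= a < f.+1)
       chi a%:Z / N`!%:R * expC ((x + a%:R) * s%:C)) E.
  apply: (@approx_sum R M _ _
    (fun a s => chi a%:Z / N`!%:R * expC ((x + a%:R) * s%:C))) => a.
  rewrite -mul_polyC.
  have := approxM (approx_poly M (chi a%:Z / N`!%:R)%:P)
    (approx_expC M (x + a%:R)).
  by apply: approx_eq_near; near=> s; rewrite hornerC.
have approxEX : approx M
    (fun s => bernoulli_poly_genfun N f chi x s%:C * genfun_denom N f s%:C)
    (E * 'X^N).
  apply: approx_eq_near (approxM approxE (approx_poly M 'X^N)).
  near=> s; have s0 : 0 < s by near: s; exact: nbhs_right_gt.
  rewrite /bernoulli_poly_genfun -mulr_suml divfK ?genfun_denom_neq0 //.
  rewrite hornerXn mulr_suml; apply: eq_bigr => a _; move: (expC _) => e.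
  by rewrite -!mulrA; congr (_ * _); rewrite [RHS]mulrC -mulrA [RHS]mulrCA.
(* The numerator now has two expansions, directly and as quotient times denominator; uniqueness
   equates their coefficients. *)
have := approx_inj approxEX (approxM approxG (approx_genfun_denom R n.+1 N f)).
rewrite mulrA => EG.
have inv := @hypergeom_bernoulli_inversion _ N f%:R n c
  (fun j => power_sum_poly f chi j x / j`!%:R) fC0.
have -> : b n = n`!%:R * c n by rewrite mulrC divfK.
rewrite inv => [|j j_n].
  rewrite mulr_sumr; apply: eq_big_nat => k /andP[_ k_n].
  (* The quotient [n! / (n-k)!], from the normalizations of [b] and of the power sums, is [k!] times
     the binomial coefficient. *)
  rewrite -(bin_fact (n := n) (m := k)) // !natrM.
  (* The integer exponent may be negative, so it is split into two natural powers. *)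
  have -> : f%:R ^ (N%:Z - k%:Z) = f%:R ^+ N / f%:R ^+ k :> R[i].
    by rewrite expfzDr // exprnN.
  have fX m : f%:R ^+ m != 0 :> R[i] by rewrite expf_neq0.
  have := fX N; have := fX k; have := n0 (n - k)%N.
  move: (_ ^+ N) (_ ^+ k) (_`!%:R) => fN fk d d0 fk0 fN0.
  by field; rewrite fk0 fN0.
(* Reading the coefficient at [j + N] cancels the common factor [X^N]. *)
have := EG (j + N)%N; rewrite !coefMXn [(_ < N)%N]ltnNge leq_addl addnK /=.
rewrite ltn_add2r ltnS => /(_ j_n).
rewrite coefM => eq_j; transitivity (E`_j); last first.
  rewrite coef_sum /power_sum_poly !mulr_suml; apply: eq_bigr => a _.
  rewrite coefZ coef_poly (leq_trans _ (leq_addr N n.+1)) ?ltnS //.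
  by rewrite mulrAC -!mulrA; congr (_ * _); rewrite mulrCA.
rewrite eq_j; apply: eq_bigr => -[k k_j] _ /=; rewrite !coef_poly.
rewrite (leq_trans k_j) ?(leq_trans _ (leq_addr N n.+1)) //.
by rewrite ltnS (leq_trans (leq_subr _ _)).
Unshelve. all: by end_near. Qed.

End GeneratingFunctionCoefficients.

Unset Implicit Arguments.
Set Strict Implicit.

Theorem theorem5p1 (R : realType) (N m f : nat) (chi : int -> R[i])
    (B : nat -> R[i]) (BX : nat -> R[i] -> R[i])
    (hN : (1 <= N)%N)
    (hchi : dirichlet_character m chi) (hf : is_conductor m chi f)
    (hB : hypergeom_bernoulli_numbers N f chi B)
    (hBX : hypergeom_bernoulli_polys N f chi BX)
    (n : nat) (hn : (1 <= n)%N) :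
  B n = \sum_(0 <= k < n.+1)
          k`!%:R / f%:R ^ (N%:Z - k%:Z) * 'C(n, k)%:R
          * (\sum_(0 <= r < k.+1) Tcoef R N r k) * power_sum f chi (n - k)
  /\
  forall x : R[i],
    BX n x = \sum_(0 <= k < n.+1)
          k`!%:R / f%:R ^ (N%:Z - k%:Z) * 'C(n, k)%:R
          * (\sum_(0 <= r < k.+1) Tcoef R N r k) * power_sum_poly f chi (n - k) x.
Proof.
have f0 : (0 < f)%N.
  have [fm _ _] := hf; apply: dvdn_gt0 fm; exact: dirichlet_modulus_gt0 hchi.
split=> [|x]; last exact: bernoulli_poly_coef f0 (hBX x).
(* The numbers are the polynomials at [x = 0], for the power sums and the generating function
   alike. *)
have -> : power_sum f chi = (power_sum_poly f chi)^~ 0.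
  apply/funext => k; apply: eq_bigr => a _; by rewrite add0r.
apply: bernoulli_poly_coef f0 _.
have -> // : bernoulli_poly_genfun N f chi 0 = bernoulli_genfun N f chi.
by apply/funext => t; apply: eq_bigr => a _; rewrite add0r.
Qed.
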